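(* Let $n\ge 1$ be an integer, let $u_0,u_1,\dots,u_n$ be a sequence of (compact, nonempty) real intervals with $u_0=[0,0]$, and let $\lambda_1,\lambda_2\ge 1$ be such that the interval powers $u_i^{\lambda_1}$ and $(\nabla u_i)^{\lambda_2}$ are defined for $1\le i\le n$. If $\{u_i\}_{i=1}^n$ is piecewise alternate monotone and piecewise alternate $\mu$-monotone, and $u_i\neq[0,0]$ for every $1\le i\le n$, then $$\sum_{i=1}^{n}\Big\|u_i^{\lambda_1}\cdot(\nabla u_i)^{\lambda_2}\Big\|\le \frac{\lambda_2(n+1)^{\lambda_1}}{\lambda_1+\lambda_2}\sum_{i=1}^{n}\|\nabla u_i\|^{\lambda_1+\lambda_2}.$$
   Context: An interval is $u=[\underline{u},\overline{u}]=\{t\in\mathbb{R}:\underline{u}\le t\le\overline{u}\}$ with $\underline u\le\overline u$ real; $len(u)=\overline u-\underline u$. Product: $u\cdot v=[\min S,\max S]$ with $S=\{\underline u\,\underline v,\ \underline u\,\overline v,\ \overline u\,\underline v,\ \overline u\,\overline v\}$. gH-difference: $u\ominus_g v=[\min\{\underline u-\underline v,\overline u-\overline v\},\max\{\underline u-\underline v,\overline u-\overline v\}]$. Backward gH-difference operator: $\nabla u_i=u_i\ominus_g u_{i-1}$. Quasi-norm: $\|u\|=\max\{|\underline u|,|\overline u|\}$. Power: $u^{\lambda}=\{t^{\lambda}:t\in u\}$, considered when $t^\lambda$ is defined for all $t\in u$: $\lambda\ge1$ may be any real number if $u\subseteq[0,\infty)$, while $\lambda$ is a positive integer if $u$ contains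 negative numbers. A sequence $(u_i)$ of intervals is increasing (decreasing) if both real sequences $(\underline{u_i})$ and $(\overline{u_i})$ are increasing (decreasing), in the weak sense. It is $\mu$-increasing ($\mu$-decreasing) if $(len(u_i))$ is increasing (decreasing), weakly. A finite sequence $\{u_i\}_{i=a}^{b}$ is piecewise alternate monotone if there are indices $a=i_0<i_1<\dots<i_k=b$ ($k\ge0$) such that on each block $\{i_{j-1},\dots,i_j\}$ the sequence is increasing or decreasing, with the direction alternating from one block to the next; piecewise alternate $\mu$-monotone is defined in the same way with $\mu$-increasing/$\mu$-decreasing in place of increasing/decreasing. *)

(* Defs.v *)
From mathcomp Require Import all_boot all_order all_algebra.
From mathcomp Require Import all_classical all_reals all_analysis.
Import Order.TTheory GRing.Theory Num.Theory.
Import numFieldNormedType.Exports.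

Set Implicit Arguments.
Unset Strict Implicit.
Unset Printing Implicit Defensive.

Local Open Scope classical_set_scope.
Local Open Scope ring_scope.

Record cinterval (R : realType) := CInterval {
  lo : R;
  hi : R;
  lo_le_hi : lo <= hi }.

Section CInterval.
Variable R : realType.
Implicit Types (u v : cinterval R) (t l : R).

Definition points u : set R := [set` `[lo u, hi u]].

Definition len u : R := hi u - lo u.

Definition izero : cinterval R := CInterval (lexx 0).

Definition inorm u : R := Num.max `|lo u| `|hi u|.

Lemma min_le_max (a b : R) : Num.min a b <= Num.max a b.
Proof. by rewrite ge_min !le_max !lexx. Qed.

Definition span (a b : R) : cinterval R := CInterval (min_le_max a b).

Lemma imul_subproof (a b c d : R) :
  Num.min (Num.min a b) (Num.min c d) <= Num.max (Num.max a b) (Num.max c d).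
Proof. by rewrite !ge_min !le_max !lexx. Qed.

Definition imul u v : cinterval R :=
  CInterval (imul_subproof (lo u * lo v) (lo u * hi v)
                           (hi u * lo v) (hi u * hi v)).

Definition gH_diff u v : cinterval R := span (lo u - lo v) (hi u - hi v).

Definition nabla (u : nat -> cinterval R) (i : nat) : cinterval R :=
  gH_diff (u i) (u i.-1).

(* [powR] is only meaningful on nonnegative bases, so natural exponents use
   the ring power; the two agree for t >= 0 ([powR_mulrn]). The value is junk
   for t < 0 and l not a natural number, which [ipow_defined] excludes. *)
Definition rpow t l : R :=
  if l \is a Num.nat then t ^+ Num.truncn l else t `^ l.

Definition ipow_defined u l : Prop :=
  forall t, points u t -> 0 <= t \/ l \is a Num.nat.

(* The interval with the same endpoints as {t^l : t in u}; [points_ipow] shows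
   that it is that set whenever the power is defined. *)
Definition ipow u l : cinterval R :=
  let S := [set rpow t l | t in points u] in span (inf S) (sup S).

Lemma span_points (S : set R) (a b : R) :
  a <= b -> S = [set` `[a, b]] -> points (span (inf S) (sup S)) = S.
Proof.
move=> ab ->; rewrite /points /= inf_itv ?bnd_simp// sup_itv ?bnd_simp//.
by rewrite (min_idPl ab) (max_idPr ab).
Qed.

Lemma points_ipow u l : 1 <= l -> ipow_defined u l ->
  points (ipow u l) = [set rpow t l | t in points u].
Proof.
move=> l1 ud; have uab := lo_le_hi u.
rewrite /ipow; have [lN|lN] := boolP (l \is a Num.nat).
  have -> : [set rpow t l | t in points u]
            = [set t ^+ Num.truncn l | t in points u].
    by rewrite /rpow lN.
  set f := fun t : R => t ^+ Num.truncn l.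
  have cf : {within `[lo u, hi u], continuous f}.
    by apply: continuous_subspaceT => x; exact: exprn_continuous.
  have [c cu fc] := EVT_max uab cf.
  have [d du fd] := EVT_min uab cf.
  apply: (@span_points _ (f d) (f c)); first exact: fc.
  apply/seteqP; split=> [_ [t tu <-]|y yfdc].
    by rewrite /= in_itv/= fd// fc.
  have sub a b : points u a -> points u b -> a <= b ->
      {within `[a, b], continuous f}.
    by move=> *; apply: continuous_subspaceT => x; exact: exprn_continuous.
  have [dc|/ltW cd] := leP d c.
    have [|x xdc <-] := @IVT _ f d c y dc (sub _ _ du cu dc).
      by rewrite (min_idPl (fd _ cu)) (max_idPr (fd _ cu)).
    exists x => //; move: xdc du cu; rewrite /points/= !in_itv/=.
    by move=> /andP[? ?] /andP[ud' _] /andP[_ cu'];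
      rewrite (le_trans ud')//= (le_trans _ cu').
  have [|x xdc <-] := @IVT _ f c d y cd (sub _ _ cu du cd).
    by rewrite minC maxC (min_idPl (fd _ cu)) (max_idPr (fd _ cu)).
  exists x => //; move: xdc du cu; rewrite /points/= !in_itv/=.
  by move=> /andP[? ?] /andP[_ du'] /andP[cu' _];
    rewrite (le_trans cu')//= (le_trans _ du').
have l0 : 0 < l by exact: lt_le_trans l1.
have a0 : 0 <= lo u.
  have /ud[//|] : points u (lo u) by rewrite /points/= in_itv/= lexx.
  by rewrite (negbTE lN).
rewrite /rpow (negbTE lN).
apply: (@span_points _ (lo u `^ l) (hi u `^ l)).
  by rewrite ge0_ler_powR ?nnegrE// ?(ltW l0)// (le_trans a0).
apply/seteqP; split=> [_ [t tu <-]|y].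
  move: tu; rewrite /points/= !in_itv/= => /andP[ut tu].
  have t0 := le_trans a0 ut.
  by rewrite !ge0_ler_powR ?nnegrE// ?(ltW l0)// (le_trans a0).
rewrite /= in_itv/= => /andP[uy yu].
have y0 : 0 <= y by rewrite (le_trans _ uy)// powR_ge0.
have b0 : 0 <= hi u by rewrite (le_trans a0).
have lV : 0 <= l^-1 by rewrite invr_ge0 ltW.
have powK x : 0 <= x -> (x `^ l) `^ l^-1 = x.
  by move=> x0; rewrite -powRrM divff ?gt_eqF// powRr1.
exists (y `^ l^-1); last by rewrite -powRrM mulVf ?gt_eqF// powRr1.
rewrite /points/= in_itv/= -{1}(powK _ a0) -{1}(powK _ b0).
by rewrite !ge0_ler_powR ?nnegrE ?powR_ge0.
Qed.

(* The direction [up] of the first block may be chosen freely; a block on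
   which the sequence is constant can play either role. *)
Definition piecewise_alternate (inc dec : nat -> nat -> Prop) (a b : nat) :=
  exists (k : nat) (ix : nat -> nat) (up : bool),
    [/\ ix 0%N = a, ix k = b,
        forall j, (j < k)%N -> (ix j < ix j.+1)%N
      & forall j, (j < k)%N ->
          if up (+) odd j then inc (ix j) (ix j.+1)
          else dec (ix j) (ix j.+1)].

Definition increasing_on (f : nat -> R) (p q : nat) : Prop :=
  {in [pred i | (p <= i <= q)%N] &, {homo f : i j / (i <= j)%N >-> i <= j}}.

Definition decreasing_on (f : nat -> R) (p q : nat) : Prop :=
  {in [pred i | (p <= i <= q)%N] &, {homo f : i j / (i <= j)%N >-> j <= i}}.

Definition piecewise_alternate_monotone (u : nat -> cinterval R) :=
  piecewise_alternate
    (fun p q => increasing_on (fun i => lo (u i)) p q /\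
      increasing_on (fun i => hi (u i)) p q)
    (fun p q => decreasing_on (fun i => lo (u i)) p q /\
      decreasing_on (fun i => hi (u i)) p q).

Definition piecewise_alternate_mu_monotone (u : nat -> cinterval R) :=
  piecewise_alternate (increasing_on (fun i => len (u i)))
                      (decreasing_on (fun i => len (u i))).

End CInterval.

Arguments izero {R}.

(* Main.v *)
Require Import Defs.
From mathcomp Require Import all_boot all_order all_algebra.
From mathcomp Require Import all_classical all_reals all_analysis.
From mathcomp Require Import ring lra.
Import Order.TTheory GRing.Theory Num.Theory.

(** The inequality reduces to one about real numbers. The quasi-norm is
    submultiplicative ([inorm_imul_le]) and compatible with powers
    ([inorm_ipow_le]), so each summand on the left is at most
    ||u_i||^l1 * d_i^l2, where d_i = ||nabla u_i||. Adding the gH-difference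
    back gives ||u_i|| <= ||u_(i-1)|| + d_i ([inorm_le_add_gH_diff]); as
    u_0 = 0, this telescopes to ||u_i|| <= S_i := d_1 + ... + d_i
    ([inorm_le_sum_nabla]).

    What remains is a discrete Opial inequality ([discrete_opial]):
      (p + q) * sum_i S_i^p d_i^q <= q (n+1)^p * sum_i d_i^(p+q).
    It is proved by induction on n. For the new term, of index m, write
    A = S_m / m. Weighted AM-GM ([weighted_young]) gives
      (p + q) A^p d_m^q <= p A^(p+q) + q d_m^(p+q),
    and the power mean inequality ([powR_mean_le]) bounds m A^(p+q) by
    D_m := d_1^(p+q) + ... + d_m^(p+q). Multiplied by m^p, the new term
    therefore costs at most p m^(p-1) D_m + q m^p d_m^(p+q). The induction
    hypothesis has constant q m^p, so the whole sum is at most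
    (q m^p + p m^(p-1)) D_m, and p m^(p-1) <= (m+1)^p - m^p
    ([bernoulli_succ]) together with q >= 1 closes the induction.

    The power mean and Bernoulli inequalities both come from the tangent line
    of x^r, which is itself the case q = 1 of weighted AM-GM. *)

Set Implicit Arguments.
Unset Strict Implicit.
Unset Printing Implicit Defensive.

Local Open Scope ring_scope.

(** * Inequalities for real powers *)

Lemma powR_mulSr (R : realType) (x r : R) :
  0 <= x -> 1 <= r -> x `^ r = x `^ (r - 1) * x.
Proof.
move=> x0 r1; rewrite -[X in _ * X](powRr1 x0) -powRD ?subrK//.
by rewrite gt_eqF// (lt_le_trans ltr01).
Qed.

(** This is Young's inequality for x^p and y^q with the conjugate exponents
    (p+q)/p and (p+q)/q; the degenerate case p = 0 is needed for the tangent
    line at exponent 1. *)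
Lemma weighted_young (R : realType) (p q x y : R) :
  0 <= p -> 0 < q -> 0 <= x -> 0 <= y ->
  (p + q) * (x `^ p * y `^ q) <= p * x `^ (p + q) + q * y `^ (p + q).
Proof.
move=> p0 q0 x0 y0; have [->|pn0] := eqVneq p 0.
  by rewrite powRr0 !mul0r !add0r mul1r.
have {pn0}p0 : 0 < p by rewrite lt_neqAle eq_sym pn0.
have r0 : 0 < p + q by rewrite addr_gt0.
have pn0 : p != 0 by rewrite gt_eqF.
have qn0 : q != 0 by rewrite gt_eqF.
have rn0 : p + q != 0 by rewrite gt_eqF.
have := @conjugate_powR R (x `^ p) (y `^ q) ((p + q) / p) ((p + q) / q).
rewrite !powR_ge0 !divr_gt0// -!powRrM => /(_ isT isT isT isT).
have -> : p * ((p + q) / p) = p + q by field.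
have -> : q * ((p + q) / q) = p + q by field.
have -> : ((p + q) / p)^-1 + ((p + q) / q)^-1 = 1.
  by field; rewrite pn0 qn0 rn0.
move=> /(_ erefl) /(ler_wpM2l (ltW r0)) /le_trans; apply.
by rewrite le_eqVlt; apply/orP; left; apply/eqP; field; rewrite pn0 qn0 rn0.
Qed.

(** The convex function x^r lies above its tangent at a. The inequality is
    written without a difference d - a, so that it is Young's inequality for
    a^(r-1) * d^1. *)
Lemma powR_tangent (R : realType) (r a d : R) :
  1 <= r -> 0 <= a -> 0 <= d ->
  r * (a `^ (r - 1) * d) <= (r - 1) * a `^ r + d `^ r.
Proof.
move=> r1 a0 d0.
have := @weighted_young R (r - 1) 1 a d _ ltr01 a0 d0.
by rewrite subrK powRr1// mul1r subr_ge0; apply.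
Qed.

(** Sum the tangent lines of x^r at the mean of the d i: the linear terms
    cancel. *)
Lemma powR_mean_le (R : realType) (m : nat) (r : R) (d : nat -> R) :
  (0 < m)%N -> 1 <= r -> (forall i, 0 <= d i) ->
  m%:R * ((\sum_(1 <= i < m.+1) d i) / m%:R) `^ r
    <= \sum_(1 <= i < m.+1) d i `^ r.
Proof.
move=> m0 r1 d0; set S := \sum_(1 <= i < m.+1) d i; set a := S / m%:R.
have mR : 0 < m%:R :> R by rewrite ltr0n.
have a0 : 0 <= a by rewrite divr_ge0// sumr_ge0.
have : \sum_(1 <= i < m.+1) r * (a `^ (r - 1) * d i)
    <= \sum_(1 <= i < m.+1) ((r - 1) * a `^ r + d i `^ r).
  by apply: ler_sum => i _; exact: powR_tangent.
rewrite -!mulr_sumr big_split/= big_const_nat subSS subn0 iter_addr_0 -/S.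
have -> : S = a * m%:R by rewrite /a divfK ?gt_eqF.
rewrite [_ `^ _ * (a * _)]mulrA -powR_mulSr// -mulr_natr; lra.
Qed.

(** The tangent of x^p at m, evaluated at m + 1; it controls the growth of the
    constant in [discrete_opial] from one index to the next. *)
Lemma bernoulli_succ (R : realType) (m : nat) (p : R) : 1 <= p ->
  p * m%:R `^ (p - 1) <= m.+1%:R `^ p - m%:R `^ p :> R.
Proof.
move=> p1.
have := @powR_tangent R p m%:R m.+1%:R p1 (ler0n _ _) (ler0n _ _).
rewrite -natr1 mulrDr mulr1 -powR_mulSr ?ler0n//; lra.
Qed.

(** * The discrete Opial inequality *)

(** The constant q (n+1)^p is what makes the induction close: the constant at
    the previous index is q m^p with m = n+1, exactly the coefficient that AM-GM
    gives to the new term d_m^(p+q), so that the sum up to m appears as a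
    common factor. *)
Lemma discrete_opial (R : realType) (n : nat) (p q : R) (d : nat -> R) :
  1 <= p -> 1 <= q -> (forall i, 0 <= d i) ->
  (p + q) * (\sum_(1 <= i < n.+1) (\sum_(1 <= j < i.+1) d j) `^ p * d i `^ q)
    <= q * n.+1%:R `^ p * \sum_(1 <= i < n.+1) d i `^ (p + q).
Proof.
move=> p1 q1 d0; elim: n => [|n IH]; first by rewrite !big_geq// !mulr0.
rewrite big_nat_recr//=.
set m := n.+1 in IH *; set S := \sum_(1 <= j < m.+1) d j.
have mR : 0 < m%:R :> R by rewrite ltr0n.
set A := S / m%:R.
have A0 : 0 <= A by rewrite divr_ge0// sumr_ge0.
have -> : S = m%:R * A by rewrite mulrC divfK ?gt_eqF.
have mean := @powR_mean_le R m (p + q) d isT _ d0.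
have young := @weighted_young R p q A (d m) _ _ A0 (d0 m).
have {}mean : m%:R * A `^ (p + q) <= \sum_(1 <= i < m.+1) d i `^ (p + q).
  by apply: mean; lra.
have {}young : (p + q) * (A `^ p * d m `^ q)
    <= p * A `^ (p + q) + q * d m `^ (p + q) by apply: young; lra.
have bern := @bernoulli_succ R m p p1.
have mS : m%:R `^ p = m%:R `^ (p - 1) * m%:R :> R.
  by rewrite powR_mulSr// ltW.
rewrite powRM ?ler0n//.
have D0 : 0 <= \sum_(1 <= i < m.+1) d i `^ (p + q).
  by apply: sumr_ge0 => i _; exact: powR_ge0.
move: mean D0; rewrite big_nat_recr//= => mean D0.
set D := \sum_(1 <= i < m) d i `^ (p + q) in IH mean D0 *.
set X := \sum_(1 <= i < m) _ in IH *.
set e := d m `^ (p + q) in mean young D0 *.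
rewrite mS in IH bern *.
set M := m%:R `^ (p - 1) in IH bern *.
have M0 : 0 <= M := powR_ge0 _ _.
set N := m.+1%:R `^ p in bern *.
set B := A `^ (p + q) in mean young.
(* The constant q m^p + p m^(p-1), with M = m^(p-1), lies between what the
   terms cost and the target q (m+1)^p. *)
apply: (@le_trans _ _ ((q * (M * m%:R) + p * M) * (D + e))); last first.
  apply: ler_wpM2r => //.
  have gap0 : 0 <= N - M * m%:R.
    by apply: le_trans bern; rewrite mulr_ge0// (le_trans ler01).
  have := ler_wpM2r gap0 q1; lra.
have h1 := ler_wpM2l (mulr_ge0 M0 (ltW mR)) young.
have h2 := ler_wpM2l (mulr_ge0 (le_trans ler01 p1) M0) mean.
lra.
Qed.

(** * The quasi-norm *)

Lemma inorm_ge0 (R : realType) (u : cinterval R) : 0 <= inorm u.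
Proof. by rewrite /inorm le_max normr_ge0. Qed.

Lemma inorm_le (R : realType) (u : cinterval R) (c : R) :
  `|lo u| <= c -> `|hi u| <= c -> inorm u <= c.
Proof. by move=> l h; rewrite /inorm ge_max l. Qed.

Lemma norm_lo_le (R : realType) (u : cinterval R) : `|lo u| <= inorm u.
Proof. by rewrite /inorm le_max lexx. Qed.

Lemma norm_hi_le (R : realType) (u : cinterval R) : `|hi u| <= inorm u.
Proof. by rewrite /inorm le_max lexx orbT. Qed.

Lemma norm_point_le (R : realType) (u : cinterval R) (t : R) :
  points u t -> `|t| <= inorm u.
Proof.
rewrite /points/= in_itv/= => /andP[lt th].
have := norm_lo_le u; have := norm_hi_le u.
by rewrite !ler_norml => /andP[_ h] /andP[l _]; rewrite (le_trans l) ?(le_trans th).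
Qed.

Lemma inorm_le_points (R : realType) (u : cinterval R) (c : R) :
  (forall t, points u t -> `|t| <= c) -> inorm u <= c.
Proof.
by move=> uc; apply: inorm_le; apply: uc;
  rewrite /points/= in_itv/= lexx lo_le_hi.
Qed.

Lemma norm_min_le (R : realType) (x y c : R) :
  `|x| <= c -> `|y| <= c -> `|Num.min x y| <= c.
Proof. by rewrite minEle; case: ifP. Qed.

Lemma norm_max_le (R : realType) (x y c : R) :
  `|x| <= c -> `|y| <= c -> `|Num.max x y| <= c.
Proof. by rewrite maxEle; case: ifP. Qed.

Lemma inorm_imul_le (R : realType) (u v : cinterval R) :
  inorm (imul u v) <= inorm u * inorm v.
Proof.
have prod_le x y : `|x| <= inorm u -> `|y| <= inorm v ->
  `|x * y| <= inorm u * inorm v by move=> *; rewrite normrM ler_pM.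
by apply: inorm_le; [apply: norm_min_le|apply: norm_max_le];
  do [apply: norm_min_le|apply: norm_max_le];
  apply: prod_le; rewrite ?norm_lo_le ?norm_hi_le.
Qed.

(** For a natural exponent the base may be negative; the absolute value makes
    both branches of [rpow] a real power of a nonnegative base. *)
Lemma norm_rpow (R : realType) (t l : R) :
  0 <= l -> 0 <= t \/ l \is a Num.nat -> `|rpow t l| = `|t| `^ l.
Proof.
move=> l0 tl; rewrite /rpow; case: ifPn => lN.
  by rewrite -[in RHS](truncnK lN) powR_mulrn ?normr_ge0// normrX.
case: tl => [t0|]; last by rewrite (negbTE lN).
by rewrite (ger0_norm t0) ger0_norm// powR_ge0.
Qed.

(** The infimum and supremum defining the power are attained, so its endpoints
    are values t^l with t in u. *)
Lemma inorm_ipow_le (R : realType) (u : cinterval R) (l : R) :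
  1 <= l -> ipow_defined u l -> inorm (ipow u l) <= inorm u `^ l.
Proof.
move=> l1 ul; have l0 : 0 <= l by lra.
apply: inorm_le_points => s; rewrite points_ipow// => -[t tu <-].
rewrite norm_rpow//; last exact: ul.
by rewrite ge0_ler_powR ?nnegrE ?inorm_ge0 ?norm_point_le.
Qed.

(** The endpoints of the gH-difference are the two endpoint differences in some
    order, so its quasi-norm dominates both, whichever order occurs. *)
Lemma inorm_le_add_gH_diff (R : realType) (u v : cinterval R) :
  inorm u <= inorm v + inorm (gH_diff u v).
Proof.
have diff_le : `|lo u - lo v| <= inorm (gH_diff u v)
    /\ `|hi u - hi v| <= inorm (gH_diff u v).
  have := norm_lo_le (gH_diff u v); have := norm_hi_le (gH_diff u v).
  by rewrite /= minEle maxEle; case: ifP.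
have [dl dh] := diff_le.
apply: inorm_le.
  rewrite -[lo u](subrK (lo v)) addrC (le_trans (ler_normD _ _))//.
  by rewrite lerD// norm_lo_le.
rewrite -[hi u](subrK (hi v)) addrC (le_trans (ler_normD _ _))//.
by rewrite lerD// norm_hi_le.
Qed.

Lemma inorm_le_sum_nabla (R : realType) (u : nat -> cinterval R) (i : nat) :
  u 0%N = izero ->
  inorm (u i) <= \sum_(1 <= j < i.+1) inorm (nabla u j).
Proof.
move=> u0; elim: i => [|i IH]; first by rewrite u0 /inorm normr0 maxxx big_geq.
rewrite big_nat_recr//=.
by apply: (le_trans (inorm_le_add_gH_diff (u i.+1) (u i))); rewrite lerD2r.
Qed.

Theorem theorem3p10 (R : realType) (n : nat) (u : nat -> cinterval R)
    (l1 l2 : R) (hn : (1 <= n)%N) (hu0 : u 0%N = izero)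
    (hl1 : 1 <= l1) (hl2 : 1 <= l2)
    (hpow1 : forall i, (1 <= i <= n)%N -> ipow_defined (u i) l1)
    (hpow2 : forall i, (1 <= i <= n)%N -> ipow_defined (nabla u i) l2)
    (hmono : piecewise_alternate_monotone u 1 n)
    (hmu : piecewise_alternate_mu_monotone u 1 n)
    (hnz : forall i, (1 <= i <= n)%N -> u i <> izero) :
  \sum_(1 <= i < n.+1) inorm (imul (ipow (u i) l1) (ipow (nabla u i) l2))
    <= l2 * n.+1%:R `^ l1 / (l1 + l2)
       * \sum_(1 <= i < n.+1) inorm (nabla u i) `^ (l1 + l2).
Proof.
have l12 : 0 < l1 + l2 by lra.
have := @discrete_opial R n l1 l2 (fun i => inorm (nabla u i)) hl1 hl2
  (fun i => inorm_ge0 _).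
rewrite -ler_pdivlMl// => opial.
rewrite mulrAC [leRHS]mulrC; apply: le_trans opial.
rewrite big_nat_cond [leRHS]big_nat_cond; apply: ler_sum => i.
rewrite andbT ltnS => iN.
apply: (le_trans (inorm_imul_le _ _)).
apply: ler_pM; rewrite ?inorm_ge0//.
  apply: (le_trans (inorm_ipow_le hl1 (hpow1 _ iN))).
  rewrite ge0_ler_powR ?nnegrE ?inorm_ge0 ?inorm_le_sum_nabla//; first by lra.
  by apply: sumr_ge0 => j _; exact: inorm_ge0.
exact: inorm_ipow_le hl2 (hpow2 _ iN).
Qed.
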